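(* Suppose that, for every $x\in X$, $u\in\mathbb{R}^p_+$ and $v\in\mathbb{R}^q$, the function $f(x,\cdot)$ is pseudoconvex over $Y(x)\cup\mathcal{Z}'(x,u,v)$ and the function $u^Tg(x,\cdot)+v^Th(x,\cdot)$ is quasiconvex over $Y(x)\cup\mathcal{Z}'(x,u,v)$, and that for every $x\in X$ the problem $(\mathrm{P}_x)$ satisfies the Guignard constraint qualification at some solution $y_x\in S(x)$. Then, if $(\bar x,\bar y)$ is a (globally) optimal solution to (BP), there exists $(\bar z,\bar u,\bar v)\in\mathbb{R}^m\times\mathbb{R}^p\times\mathbb{R}^q$ such that $(\bar x,\bar y,\bar z,\bar u,\bar v)$ is a (globally) optimal solution to (eMDP). Conversely, if $(\bar x,\bar y,\bar z,\bar u,\bar v)$ is a (globally) optimal solution to (eMDP), then $(\bar x,\bar y)$ is a (globally) optimal solution to (BP).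
   Context: Data: $\Omega\subseteq\mathbb{R}^{n+m}$ is a set; $F:\mathbb{R}^{n+m}\to\mathbb{R}$ is continuously differentiable; $f:\mathbb{R}^{n+m}\to\mathbb{R}$, $g:\mathbb{R}^{n+m}\to\mathbb{R}^p$, $h:\mathbb{R}^{n+m}\to\mathbb{R}^q$ are twice continuously differentiable. For $x\in\mathbb{R}^n$, the lower-level problem is $(\mathrm{P}_x)$: $\min_y f(x,y)$ s.t. $g(x,y)\le 0$, $h(x,y)=0$; its feasible set is $Y(x)=\{y\in\mathbb{R}^m: g(x,y)\le0,\ h(x,y)=0\}$ and its set of (global) optimal solutions is $S(x)$. Let $X=\{x\in\mathbb{R}^n:\exists y\in\mathbb{R}^m,\ (x,y)\in\Omega\}$. Standing assumption: $S(x)\ne\emptyset$ for each $x\in X$. The bilevel program is (BP): $\min F(x,y)$ s.t. $(x,y)\in\Omega$, $y\in S(x)$. Lagrangian: $L(x,z,u,v)=f(x,z)+u^Tg(x,z)+v^Th(x,z)$; $\nabla_z$ denotes the gradient with respect to the second block of variables, and for vector-valued maps the matrix whose columns are the gradients of the components. $\circ$ denotes the Hadamard (componentwise) product. (eMDP): minimize $F(x,y)$ over $(x,y,z,u,v)\in\mathbb{R}^n\times\mathbb{R}^m\times\mathbb{R}^m\times\mathbb{R}^p\times\mathbb{R}^q$ s.t. $(x,y)\in\Omega$, $g(x,y)\le0$, $h(x,y)=0$, $f(x,y)-f(x,z)\le0$, $u\circ g(x,z)\ge0$, $v\circ h(x,z)=0$, $\nabla_zf(x,z)+\nabla_zg(x,z)u+\nabla_zh(x,z)v=0$,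 $u\ge0$. $\mathcal{Z}'(x,u,v)=\{z\in\mathbb{R}^m:\nabla_zL(x,z,u,v)=0,\ u\circ g(x,z)\ge0,\ v\circ h(x,z)=0\}$. A differentiable $\varphi:\mathbb{R}^m\to\mathbb{R}$ is pseudoconvex on $\mathcal{Y}\subseteq\mathbb{R}^m$ if for all $y_1,y_2\in\mathcal{Y}$, $(y_1-y_2)^T\nabla\varphi(y_2)\ge0$ implies $\varphi(y_1)\ge\varphi(y_2)$; it is quasiconvex on $\mathcal{Y}$ if for all $y_1,y_2\in\mathcal{Y}$, $\varphi(y_1)\le\varphi(y_2)$ implies $(y_1-y_2)^T\nabla\varphi(y_2)\le0$. (The set $\mathcal{Y}$ need not be convex.) Guignard constraint qualification for $(\mathrm{P}_x)$ at $\bar y\in Y(x)$: $\mathcal{L}_{Y(x)}(\bar y)^\circ=\mathcal{T}_{Y(x)}(\bar y)^\circ$, where $\mathcal{T}_{Y(x)}(\bar y)=\{d:\exists\{y^k\}\subseteq Y(x),\ \exists\, t_k\downarrow0,\ y^k\to\bar y,\ (y^k-\bar y)/t_k\to d\}$, $\mathcal{L}_{Y(x)}(\bar y)=\{d:\nabla_yg_i(x,\bar y)^Td\le0 \text{ for all } i \text{ with } g_i(x,\bar y)=0,\ \nabla_yh_j(x,\bar y)^Td=0,\ j=1,\dots,q\}$, and $D^\circ=\{d:d^Ty\le0\ \forall y\in D\}$ denotes the polar cone. *)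

(* Defs.v *)
From HB Require Import structures.
From mathcomp Require Import all_boot all_order all_algebra.
From mathcomp Require Import all_classical all_reals all_analysis.

Set Implicit Arguments.
Unset Strict Implicit.
Unset Printing Implicit Defensive.

Import Order.TTheory GRing.Theory Num.Theory.
Import numFieldNormedType.Exports.
Local Open Scope classical_set_scope.
Local Open Scope ring_scope.

(* R^k is 'cV[R]_k, and a point (x, y) of R^(n+m) is col_mx x y. *)

Definition dot {R : realType} {k : nat} (a b : 'cV[R]_k) : R :=
  (a^T *m b) 0 0.

Definition hadamard {R : realType} {k : nat} (a b : 'cV[R]_k) : 'cV[R]_k :=
  map2_mx *%R a b.

Definition nonnegv {R : realType} {k : nat} (a : 'cV[R]_k) : Prop :=
  forall i, 0 <= a i 0.

Definition nonposv {R : realType} {k : nat} (a : 'cV[R]_k) : Prop :=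
  forall i, a i 0 <= 0.

Definition grad {R : realType} {k : nat} (phi : 'cV[R]_k -> R)
    (a : 'cV[R]_k) : 'cV[R]_k :=
  \col_i 'D_(delta_mx i 0) phi a.

(* Column j is the gradient of the j-th component: this is the transpose of
   the usual Jacobian matrix. *)
Definition gradv {R : realType} {k l : nat} (G : 'cV[R]_k -> 'cV[R]_l)
    (a : 'cV[R]_k) : 'M[R]_(k, l) :=
  \matrix_(i, j) grad (fun w => G w j 0) a i 0.

Definition C1 {R : realType} {k : nat} (phi : 'cV[R]_k -> R) : Prop :=
  (forall a, differentiable phi a) /\ continuous (grad phi).

Definition C2 {R : realType} {k : nat} (phi : 'cV[R]_k -> R) : Prop :=
  C1 phi /\ forall i, C1 (fun a => grad phi a i 0).

Definition C2v {R : realType} {k l : nat} (G : 'cV[R]_k -> 'cV[R]_l) : Prop :=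
  forall j, C2 (fun a => G a j 0).

(* The next two notions are meant for phi differentiable; D is not required
   to be convex. *)
Definition pseudoconvex_on {R : realType} {k : nat} (D : set 'cV[R]_k)
    (phi : 'cV[R]_k -> R) : Prop :=
  forall y1 y2, D y1 -> D y2 ->
    0 <= dot (y1 - y2) (grad phi y2) -> phi y2 <= phi y1.

Definition quasiconvex_on {R : realType} {k : nat} (D : set 'cV[R]_k)
    (phi : 'cV[R]_k -> R) : Prop :=
  forall y1 y2, D y1 -> D y2 ->
    phi y1 <= phi y2 -> dot (y1 - y2) (grad phi y2) <= 0.

Definition global_min {R : realType} {T : Type} (obj : T -> R)
    (feas : set T) : set T :=
  [set a | feas a /\ forall b, feas b -> obj a <= obj b].

Definition polar {R : realType} {k : nat} (D : set 'cV[R]_k) : set 'cV[R]_k :=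
  [set d | forall y, D y -> dot d y <= 0].

Definition tangent_cone {R : realType} {k : nat} (D : set 'cV[R]_k)
    (a : 'cV[R]_k) : set 'cV[R]_k :=
  [set d | exists (y : nat -> 'cV[R]_k) (t : nat -> R),
    [/\ forall i, D (y i), forall i, 0 < t i,
        t @ \oo --> (0 : R), y @ \oo --> a &
        (fun i => (t i)^-1 *: (y i - a)) @ \oo --> d]].

Definition lower_feas {R : realType} {n m p q : nat}
    (g : 'cV[R]_(n + m) -> 'cV[R]_p) (h : 'cV[R]_(n + m) -> 'cV[R]_q)
    (x : 'cV[R]_n) : set 'cV[R]_m :=
  [set y | nonposv (g (col_mx x y)) /\ h (col_mx x y) = 0].

Definition lower_sol {R : realType} {n m p q : nat}
    (f : 'cV[R]_(n + m) -> R)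
    (g : 'cV[R]_(n + m) -> 'cV[R]_p) (h : 'cV[R]_(n + m) -> 'cV[R]_q)
    (x : 'cV[R]_n) : set 'cV[R]_m :=
  global_min (fun y => f (col_mx x y)) (lower_feas g h x).

Definition upper_proj {R : realType} {n m : nat} (Omega : set 'cV[R]_(n + m)) :
    set 'cV[R]_n :=
  [set x | exists y : 'cV[R]_m, Omega (col_mx x y)].

Definition lagrangian {R : realType} {n m p q : nat}
    (f : 'cV[R]_(n + m) -> R)
    (g : 'cV[R]_(n + m) -> 'cV[R]_p) (h : 'cV[R]_(n + m) -> 'cV[R]_q)
    (x : 'cV[R]_n) (z : 'cV[R]_m) (u : 'cV[R]_p) (v : 'cV[R]_q) : R :=
  f (col_mx x z) + dot u (g (col_mx x z)) + dot v (h (col_mx x z)).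

Definition linearized_cone {R : realType} {n m p q : nat}
    (g : 'cV[R]_(n + m) -> 'cV[R]_p) (h : 'cV[R]_(n + m) -> 'cV[R]_q)
    (x : 'cV[R]_n) (y : 'cV[R]_m) : set 'cV[R]_m :=
  [set d | (forall i, g (col_mx x y) i 0 = 0 ->
              dot (grad (fun w => g (col_mx x w) i 0) y) d <= 0) /\
           (forall j, dot (grad (fun w => h (col_mx x w) j 0) y) d = 0)].

Definition guignard_cq {R : realType} {n m p q : nat}
    (g : 'cV[R]_(n + m) -> 'cV[R]_p) (h : 'cV[R]_(n + m) -> 'cV[R]_q)
    (x : 'cV[R]_n) (y : 'cV[R]_m) : Prop :=
  lower_feas g h x y /\
  polar (linearized_cone g h x y) = polar (tangent_cone (lower_feas g h x) y).

Definition Zprime {R : realType} {n m p q : nat}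
    (f : 'cV[R]_(n + m) -> R)
    (g : 'cV[R]_(n + m) -> 'cV[R]_p) (h : 'cV[R]_(n + m) -> 'cV[R]_q)
    (x : 'cV[R]_n) (u : 'cV[R]_p) (v : 'cV[R]_q) : set 'cV[R]_m :=
  [set z | [/\ grad (fun w => lagrangian f g h x w u v) z = 0,
               nonnegv (hadamard u (g (col_mx x z))) &
               hadamard v (h (col_mx x z)) = 0]].

Definition BP_feas {R : realType} {n m p q : nat}
    (Omega : set 'cV[R]_(n + m)) (f : 'cV[R]_(n + m) -> R)
    (g : 'cV[R]_(n + m) -> 'cV[R]_p) (h : 'cV[R]_(n + m) -> 'cV[R]_q) :
    set ('cV[R]_n * 'cV[R]_m) :=
  [set w | let: (x, y) := w in
    Omega (col_mx x y) /\ lower_sol f g h x y].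

Definition BP_sol {R : realType} {n m p q : nat}
    (Omega : set 'cV[R]_(n + m)) (F f : 'cV[R]_(n + m) -> R)
    (g : 'cV[R]_(n + m) -> 'cV[R]_p) (h : 'cV[R]_(n + m) -> 'cV[R]_q) :
    set ('cV[R]_n * 'cV[R]_m) :=
  global_min (fun w => let: (x, y) := w in F (col_mx x y))
    (BP_feas Omega f g h).

Definition eMDP_feas {R : realType} {n m p q : nat}
    (Omega : set 'cV[R]_(n + m)) (f : 'cV[R]_(n + m) -> R)
    (g : 'cV[R]_(n + m) -> 'cV[R]_p) (h : 'cV[R]_(n + m) -> 'cV[R]_q) :
    set ('cV[R]_n * 'cV[R]_m * 'cV[R]_m * 'cV[R]_p * 'cV[R]_q) :=
  [set w | let: (x, y, z, u, v) := w in
    [/\ Omega (col_mx x y),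
        nonposv (g (col_mx x y)),
        h (col_mx x y) = 0,
        f (col_mx x y) - f (col_mx x z) <= 0 &
    [/\ nonnegv (hadamard u (g (col_mx x z))),
        hadamard v (h (col_mx x z)) = 0,
        grad (fun z' => f (col_mx x z')) z
          + gradv (fun z' => g (col_mx x z')) z *m u
          + gradv (fun z' => h (col_mx x z')) z *m v = 0 &
        nonnegv u]]].

Definition eMDP_sol {R : realType} {n m p q : nat}
    (Omega : set 'cV[R]_(n + m)) (F f : 'cV[R]_(n + m) -> R)
    (g : 'cV[R]_(n + m) -> 'cV[R]_p) (h : 'cV[R]_(n + m) -> 'cV[R]_q) :
    set ('cV[R]_n * 'cV[R]_m * 'cV[R]_m * 'cV[R]_p * 'cV[R]_q) :=
  global_min (fun w => let: (x, y, z, u, v) := w in F (col_mx x y))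
    (eMDP_feas Omega f g h).

(* Main.v *)
(* Fix x in X.  Weak duality: if y is feasible for (P_x), u >= 0 and z is in
   Z'(x,u,v), then u.g + v.h is nonpositive at y and nonnegative at z, so
   quasiconvexity, stationarity of the Lagrangian at z and pseudoconvexity of f
   give f(x,z) <= f(x,y).  Hence every eMDP-feasible (x,y,z,u,v) has y in S(x).
   Strong duality: at the solution y_x of (P_x) where Guignard's condition
   holds, -grad f is polar to the tangent cone, hence to the linearized cone,
   and Farkas' lemma yields multipliers; as f(x,.) takes the same value at all
   points of S(x), z := y_x serves every y in S(x).  So (BP) and (eMDP) have the
   same feasible pairs (x,y), and the same objective. *)

Require Import Defs.
From HB Require Import structures.
From mathcomp Require Import all_boot all_order all_algebra.
From mathcomp Require Import all_classical all_reals all_analysis.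
From mathcomp Require Import ring lra.

Import Order.TTheory GRing.Theory Num.Theory.
Import numFieldNormedType.Exports.
Local Open Scope classical_set_scope.
Local Open Scope ring_scope.

(** * Bilinearity of the dot product *)

Lemma dotE (R : realType) (k : nat) (a b : 'cV[R]_k) :
  dot a b = \sum_i a i 0 * b i 0.
Proof. by rewrite /dot mxE; apply: eq_bigr => i _; rewrite mxE. Qed.

Lemma dotC (R : realType) (k : nat) (a b : 'cV[R]_k) : dot a b = dot b a.
Proof. by rewrite !dotE; apply: eq_bigr => i _; rewrite mulrC. Qed.

Lemma dotDl (R : realType) (k : nat) (a b c : 'cV[R]_k) :
  dot (a + b) c = dot a c + dot b c.
Proof. by rewrite /dot linearD mulmxDl mxE. Qed.

Lemma dotZl (R : realType) (k : nat) (l : R) (a b : 'cV[R]_k) :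
  dot (l *: a) b = l * dot a b.
Proof. by rewrite /dot linearZ -scalemxAl mxE. Qed.

Lemma dotNl (R : realType) (k : nat) (a b : 'cV[R]_k) :
  dot (- a) b = - dot a b.
Proof. by rewrite -scaleN1r dotZl mulN1r. Qed.

Lemma dot_suml (R : realType) (k : nat) (I : Type) (s : seq I)
    (a : I -> 'cV[R]_k) (b : 'cV[R]_k) :
  dot (\sum_(i <- s) a i) b = \sum_(i <- s) dot (a i) b.
Proof. by rewrite /dot linear_sum mulmx_suml summxE. Qed.

Lemma dotDr (R : realType) (k : nat) (a b c : 'cV[R]_k) :
  dot a (b + c) = dot a b + dot a c.
Proof. by rewrite dotC dotDl dotC [dot c a]dotC. Qed.

Lemma dotZr (R : realType) (k : nat) (l : R) (a b : 'cV[R]_k) :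
  dot a (l *: b) = l * dot a b.
Proof. by rewrite dotC dotZl dotC. Qed.

Lemma dotNr (R : realType) (k : nat) (a b : 'cV[R]_k) :
  dot a (- b) = - dot a b.
Proof. by rewrite dotC dotNl dotC. Qed.

(** * Farkas' lemma *)

(* Bartl's induction: if the last generator cannot be dropped, some [x0] has
   [a_n . x0 > 0], and projecting along [x0] onto the kernel of [a_n] leaves
   the problem with the generators [a_i - (a_i . x0) / (a_n . x0) a_n]. *)
Lemma farkas_seq (R : realType) (k N : nat) (a : nat -> 'cV[R]_k)
    (b : 'cV[R]_k) :
  (forall d, (forall i, (i < N)%N -> dot (a i) d <= 0) -> dot b d <= 0) ->
  exists2 l : nat -> R, forall i, 0 <= l i & b = \sum_(i < N) l i *: a i.
Proof.
elim: N a b => [|N IH] a b ab.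
  exists (fun=> 0) => //; rewrite big_ord0.
  (* Without generators every direction is admissible, in particular [b] itself. *)
  have : dot b b <= 0 by apply: ab.
  rewrite dotE => bb0; apply/colP => i; rewrite mxE.
  have sq (j : 'I_k) : true -> 0 <= b j 0 * b j 0 by rewrite -expr2 sqr_ge0.
  have : \sum_j b j 0 * b j 0 == 0 by rewrite eq_le bb0 sumr_ge0.
  rewrite psumr_eq0// => /allP/(_ i).
  by rewrite mem_index_enum mulf_eq0 orbb => /(_ isT)/eqP.
have [Hb|] := pselect (forall d, (forall i, (i < N)%N -> dot (a i) d <= 0) ->
    dot b d <= 0).
  have [l l0 lb] := IH a b Hb.
  exists (fun i => if (i < N)%N then l i else 0).
    by move=> i; case: ifP.
  rewrite big_ord_recr/= ltnn scale0r addr0 lb.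
  by apply: eq_bigr => i _; rewrite ltn_ord.
move=> /existsNP[x0 /not_implyP[ax0 /negP]]; rewrite -ltNge => bx0.
have aN0 : 0 < dot (a N) x0.
  rewrite ltNge; apply/negP => aN; suff : dot b x0 <= 0 by rewrite leNgt bx0.
  by apply: ab => i; rewrite ltnS leq_eqVlt => /predU1P[->//|]; apply: ax0.
pose pr c : 'cV[R]_k := c - (dot c x0 / dot (a N) x0) *: a N.
(* The adjoint of [pr] moves [d] along [x0] into the kernel of [a N], so the moved direction meets
   the constraint of [a N] with equality and [ab] applies to it. *)
have prE c d : dot (pr c) d = dot c (d - (dot (a N) d / dot (a N) x0) *: x0).
  rewrite /pr dotDl dotNl dotZl dotDr dotNr dotZr; field.
  by rewrite gt_eqF.
have [|l l0 lb] := IH (pr \o a) (pr b).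
  move=> d Hd; rewrite prE; apply: ab => i.
  rewrite ltnS leq_eqVlt => /predU1P[->|iN]; last by rewrite -prE; exact: Hd.
  by rewrite dotDr dotNr dotZr divfK ?gt_eqF// subrr.
(* The coefficient that collects on [a N] when the projections are expanded. It is nonnegative
   because [dot b x0] and [dot (a N) x0] are positive while [dot (a i) x0 <= 0] for [i < N]. *)
pose s := dot b x0 / dot (a N) x0 -
  \sum_(i < N) l i * (dot (a i) x0 / dot (a N) x0).
exists (fun i => if (i < N)%N then l i else s).
  move=> i; case: ifP => // _; rewrite subr_ge0.
  apply: (@le_trans _ _ 0); last by rewrite divr_ge0// ltW.
  apply: sumr_le0 => j _; rewrite mulr_ge0_le0// mulr_le0_ge0 ?ax0//.
  by rewrite invr_ge0 ltW.
rewrite big_ord_recr/= ltnn.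
have -> : b = pr b + (dot b x0 / dot (a N) x0) *: a N by rewrite /pr subrK.
rewrite lb /s /=.
under eq_bigr do rewrite scalerBr scalerA.
rewrite sumrB -scaler_suml scalerBl addrA addrAC; congr (_ - _ + _).
by apply: eq_bigr => i _; rewrite ltn_ord.
Qed.

(** Arbitrary finite index types allow a sum type to separate the kinds of constraints. The family
    is enumerated and padded with zero vectors. *)
Lemma farkas (R : realType) (k : nat) (I : finType) (a : I -> 'cV[R]_k)
    (b : 'cV[R]_k) :
  (forall d, (forall i, dot (a i) d <= 0) -> dot b d <= 0) ->
  exists2 l : I -> R, forall i, 0 <= l i & b = \sum_i l i *: a i.
Proof.
move=> ab.
pose a' i := if insub i is Some j then a (enum_val (j : 'I_#|I|)) else 0.
have a'E (j : 'I_#|I|) : a' j = a (enum_val j) by rewrite /a' valK.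
have [|l l0 ->] := farkas_seq _ _ #|I| a' b.
  move=> d Hd; apply: ab => i.
  by have := Hd (enum_rank i) (ltn_ord _); rewrite a'E enum_rankK.
exists (fun i => l (enum_rank i)) => //.
rewrite [RHS](reindex_onto enum_val enum_rank)/=; last first.
  by move=> i _; exact: enum_rankK.
apply: eq_big => [i|i _]; first by rewrite enum_valK eqxx.
by rewrite a'E enum_valK.
Qed.

(** * First-order optimality on the tangent cone *)

Lemma dot_grad (R : realType) (k : nat) (phi : 'cV[R]_k -> R) (a d : 'cV[R]_k) :
  differentiable phi a -> dot (grad phi a) d = 'd phi a d.
Proof.
move=> dphi; rewrite {2}[d]matrix_sum_delta dotE linear_sum.
apply: eq_bigr => i _; rewrite big_ord1 linearZ/= mxE.
by rewrite deriveE// mulrC.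
Qed.

(** Along a tangent sequence [phi] changes by [t n] times a quantity tending to ['d phi a d]. If
    that limit were negative, some [y n] would lie strictly below the minimum. *)
Lemma tangent_cone_grad_ge0 (R : realType) (k : nat) (phi : 'cV[R]_k -> R)
    (D : set 'cV[R]_k) (a d : 'cV[R]_k) :
  differentiable phi a -> (forall y, D y -> phi a <= phi y) ->
  tangent_cone D a d -> 0 <= dot (grad phi a) d.
Proof.
move=> dphi mina [y [t [Dy t0 tlim ylim elim]]].
rewrite dot_grad// leNgt; apply/negP => dneg.
(* [M] bounds the difference quotient [e] as soon as [e] is within 1 of [d]. *)
set M := `|d| + 1; have M0 : 0 < M by rewrite ltr_wpDl.
set c := - 'd phi a d; have c0 : 0 < c by rewrite oppr_gt0.
(* With this tolerance the remainder is at most [t n * (c / 4)], whereas closeness within [c / 2]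
   makes the linear term less than [- t n * (c / 2)]; their sum stays negative. *)
have eps0 : 0 < c / (4 * M) by rewrite divr_gt0// mulr_gt0.
have /eqaddoP/(_ _ eps0) ophi := diff_locally dphi.
have ya0 : (y n - a) @[n --> \oo] --> (0 : 'cV[R]_k).
  by rewrite -(subrr a); exact: (cvgB ylim (cvg_cst a)).
have dlim : ('d phi a ((t n)^-1 *: (y n - a))) @[n --> \oo] --> 'd phi a d.
  have dc : {for d, continuous ('d phi a : _ -> R)} by exact: diff_continuous.
  exact: (cvg_comp _ _ elim dc).
have [n [on en dn]] : exists n,
  [/\ `|(phi \o shift a - (cst (phi a) + 'd phi a)) (y n - a)|
        <= c / (4 * M) * `|y n - a|,
      `|d - (t n)^-1 *: (y n - a)| < 1 &
      `|'d phi a d - 'd phi a ((t n)^-1 *: (y n - a))| < c / 2].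
  apply: (@filter_ex _ \oo _); near=> n; split; near: n.
  - exact: (ya0 _ ophi).
  - by move/cvgrPdist_lt : elim => /(_ _ ltr01).
  - by move/cvgrPdist_lt : dlim => /(_ (c / 2)); apply; rewrite divr_gt0.
set e := (t n)^-1 *: (y n - a) in en dn.
have yE : y n - a = t n *: e by rewrite scalerA divff ?scale1r// gt_eqF.
have eM : `|e| <= M.
  rewrite -(subKr d e) -/M; apply: (le_trans (ler_normB _ _)).
  by rewrite lerD2l ltW.
have := mina _ (Dy n); rewrite leNgt => /negP; apply.
move: on; rewrite yE normrZ gtr0_norm// /= !fctE/= -yE subrK yE linearZ/=.
rewrite ler_norml => /andP[_ on].
move: dn; rewrite ltr_norml -/c => /andP[dn _].
have {}on : phi (y n) - (phi a + t n * 'd phi a e) <= t n * (c / 4).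
  apply: (le_trans on).
  rewrite [leLHS](_ : _ = t n * (c / (4 * M) * `|e|)); last by ring.
  rewrite ler_pM2l// invfM mulrA -[leRHS]mulr1 -mulrA ler_pM2l ?divr_gt0//.
  by rewrite mulrC ler_pdivrMr// mul1r.
have : t n * ('d phi a e + c / 4) < 0.
  by rewrite pmulr_rlt0//; rewrite /c in c0 dn *; lra.
lra.
Unshelve. all: by end_near. Qed.

(** * Differentiation with the first block fixed *)

(** In the max norm the fixed block contributes zero to the distance, so the map is nonexpansive. *)
Lemma continuous_col_mx_r (R : realType) (n m : nat) (x : 'cV[R]_n) :
  continuous (fun y : 'cV[R]_m => col_mx x y).
Proof.
move=> y; apply/(@cvgrPdist_le _ _ _ (nbhs y)) => e e0; near=> z.
have yz : `|y - z| <= e.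
  by near: z; apply: (@cvgr_dist_le _ _ _ (nbhs y) _ id) => //; exact: cvg_id.
rewrite opp_col_mx add_col_mx subrr.
rewrite [leLHS]/Num.Def.normr/= mx_normrE (bigmax_le _ (ltW e0))//= => -[i j] _ /=.
rewrite mxE; case: splitP => k _; first by rewrite mxE normr0 ltW.
apply: le_trans yz; rewrite [leRHS]/Num.Def.normr/= mx_normrE.
exact: (le_bigmax _ (fun ij => `|(y - z) ij.1 ij.2|) (k, j)).
Unshelve. all: by end_near. Qed.

(** The map is affine: a constant plus the linear embedding [L], whose continuity is the previous
    lemma at [x = 0]. *)
Lemma differentiable_col_mx_r (R : realType) (n m : nat) (x : 'cV[R]_n)
    (y : 'cV[R]_m) : differentiable (fun w : 'cV[R]_m => col_mx x w) y.
Proof.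
pose L : {linear 'cV[R]_m -> 'cV[R]_(n + m)} := mulmx (col_mx 0 1%:M).
have LE w : L w = col_mx 0 w by rewrite /L/= mul_col_mx mul0mx mul1mx.
have -> : (fun w => col_mx x w) = cst (col_mx x 0) + L.
  by apply/funext => w; rewrite !fctE LE add_col_mx addr0 add0r.
apply: differentiableD; first exact: differentiable_cst.
apply: linear_differentiable; rewrite (funext LE).
exact: continuous_col_mx_r.
Qed.

Lemma C2_differentiable_col_mx (R : realType) (n m : nat)
    (phi : 'cV[R]_(n + m) -> R) (x : 'cV[R]_n) (y : 'cV[R]_m) :
  C2 phi -> differentiable (fun w => phi (col_mx x w)) y.
Proof.
move=> [[dphi _] _].
exact: (differentiable_comp (differentiable_col_mx_r _ _ _ x y) (dphi _)).
Qed.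

Lemma gradD (R : realType) (k : nat) (phi psi : 'cV[R]_k -> R) (a : 'cV[R]_k) :
  differentiable phi a -> differentiable psi a ->
  grad (fun w => phi w + psi w) a = grad phi a + grad psi a.
Proof.
move=> dphi dpsi; apply/colP => i; rewrite !mxE.
exact: (deriveD (diff_derivable dphi) (diff_derivable dpsi)).
Qed.

(** Point-free form, to which the derivative rules for sums and multiples of functions apply. *)
Lemma dot_fctE (R : realType) (k l : nat) (u : 'cV[R]_l)
    (G : 'cV[R]_k -> 'cV[R]_l) :
  (fun w => dot u (G w)) = \sum_j (u j 0 *: ((fun w => G w j 0) : _ -> R)).
Proof. by apply/funext => w; rewrite dotE fct_sumE. Qed.

Lemma differentiable_dot (R : realType) (k l : nat) (u : 'cV[R]_l)
    (G : 'cV[R]_k -> 'cV[R]_l) (a : 'cV[R]_k) :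
  (forall j, differentiable (fun w => G w j 0) a) ->
  differentiable (fun w => dot u (G w)) a.
Proof.
move=> dG; rewrite dot_fctE; apply: differentiable_sum => j.
exact: differentiableZ.
Qed.

Lemma gradv_mul (R : realType) (k l : nat) (G : 'cV[R]_k -> 'cV[R]_l)
    (a : 'cV[R]_k) (u : 'cV[R]_l) :
  gradv G a *m u = \sum_j u j 0 *: grad (fun w => G w j 0) a.
Proof.
apply/colP => i; rewrite mxE summxE; apply: eq_bigr => j _.
by rewrite !mxE mulrC.
Qed.

Lemma grad_dot (R : realType) (k l : nat) (u : 'cV[R]_l)
    (G : 'cV[R]_k -> 'cV[R]_l) (a : 'cV[R]_k) :
  (forall j, differentiable (fun w => G w j 0) a) ->
  grad (fun w => dot u (G w)) a = gradv G a *m u.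
Proof.
move=> dG; rewrite gradv_mul; apply/colP => i; rewrite mxE summxE dot_fctE.
rewrite derive_sum => [|j]; last exact/derivableZ/diff_derivable.
apply: eq_bigr => j _; rewrite !mxE deriveZ//; exact: diff_derivable.
Qed.

(** * Weak duality and multipliers for the lower-level problem *)

Section lower_level.
Variables (R : realType) (n m p q : nat).
Variables (f : 'cV[R]_(n + m) -> R).
Variables (g : 'cV[R]_(n + m) -> 'cV[R]_p) (h : 'cV[R]_(n + m) -> 'cV[R]_q).
Hypotheses (f_C2 : C2 f) (g_C2 : C2v g) (h_C2 : C2v h).
Variable x : 'cV[R]_n.

Let df (y : 'cV[R]_m) : differentiable (fun w => f (col_mx x w)) y.
Proof. exact: (C2_differentiable_col_mx _ _ _ _ x y f_C2). Qed.

Let dg (y : 'cV[R]_m) i : differentiable (fun w => g (col_mx x w) i 0) y.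
Proof. exact: (C2_differentiable_col_mx _ _ _ _ x y (g_C2 i)). Qed.

Let dh (y : 'cV[R]_m) j : differentiable (fun w => h (col_mx x w) j 0) y.
Proof. exact: (C2_differentiable_col_mx _ _ _ _ x y (h_C2 j)). Qed.

Lemma grad_constraints (z : 'cV[R]_m) (u : 'cV[R]_p) (v : 'cV[R]_q) :
  grad (fun w => dot u (g (col_mx x w)) + dot v (h (col_mx x w))) z =
  gradv (fun w => g (col_mx x w)) z *m u + gradv (fun w => h (col_mx x w)) z *m v.
Proof.
rewrite gradD; [|exact: differentiable_dot|exact: differentiable_dot].
by rewrite !grad_dot.
Qed.

(** Matches the stationarity condition of [Zprime] with the explicit gradient equation of
    [eMDP_feas]. *)
Lemma grad_lagrangian (z : 'cV[R]_m) (u : 'cV[R]_p) (v : 'cV[R]_q) :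
  grad (fun w => lagrangian f g h x w u v) z =
  grad (fun w => f (col_mx x w)) z
    + gradv (fun w => g (col_mx x w)) z *m u
    + gradv (fun w => h (col_mx x w)) z *m v.
Proof.
rewrite /lagrangian -addrA -grad_constraints -gradD//; last first.
  by apply: differentiableD; exact: differentiable_dot.
by congr grad; apply/funext => w; rewrite addrA.
Qed.

Lemma mond_weir_weak_duality (y z : 'cV[R]_m) (u : 'cV[R]_p) (v : 'cV[R]_q) :
  pseudoconvex_on (lower_feas g h x `|` Zprime f g h x u v)
    (fun w => f (col_mx x w)) ->
  quasiconvex_on (lower_feas g h x `|` Zprime f g h x u v)
    (fun w => dot u (g (col_mx x w)) + dot v (h (col_mx x w))) ->
  nonnegv u -> lower_feas g h x y -> Zprime f g h x u v z ->
  f (col_mx x z) <= f (col_mx x y).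
Proof.
move=> fpc ghqc u0 yY zZ; apply: fpc; [by left|by right|].
have [gy hy] := yY; have [Lz ugz vhz] := zZ.
have /(ghqc y z (or_introl yY) (or_intror zZ)) :
    dot u (g (col_mx x y)) + dot v (h (col_mx x y)) <=
    dot u (g (col_mx x z)) + dot v (h (col_mx x z)).
  apply: (@le_trans _ _ 0).
    rewrite hy !dotE [X in _ + X]big1 ?addr0; last by move=> j _; rewrite mxE mulr0.
    by apply: sumr_le0 => i _; rewrite mulr_ge0_le0.
  rewrite !dotE addr_ge0// sumr_ge0// => i _.
    by have := ugz i; rewrite mxE.
  by have := congr1 (fun w : 'cV__ => w i 0) vhz; rewrite !mxE => ->.
(* Stationarity makes the two gradients opposite, which turns the sign given by quasiconvexity along
   [y - z] into the one pseudoconvexity asks for. *)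
have : grad (fun w => f (col_mx x w)) z =
    - grad (fun w => dot u (g (col_mx x w)) + dot v (h (col_mx x w))) z.
  by rewrite grad_constraints; apply/eqP; rewrite -addr_eq0 addrA -grad_lagrangian Lz.
by move=> ->; rewrite dotNr oppr_ge0.
Qed.

Lemma guignard_kkt (y : 'cV[R]_m) :
  lower_sol f g h x y -> guignard_cq g h x y ->
  exists u v, nonnegv u /\ Zprime f g h x u v y.
Proof.
move=> [[gy hy] ymin] [_ LT].
have df_polar : polar (linearized_cone g h x y) (- grad (fun w => f (col_mx x w)) y).
  rewrite LT => d dT; rewrite dotNl oppr_le0.
  exact: tangent_cone_grad_ge0 dT.
(* Each equality constraint enters as two opposite generators, and each inactive inequality as the
   zero generator. *)
pose a (s : 'I_p + ('I_q + 'I_q)) := match s with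
  | inl i => if g (col_mx x y) i 0 == 0
             then grad (fun w => g (col_mx x w) i 0) y else 0
  | inr (inl j) => grad (fun w => h (col_mx x w) j 0) y
  | inr (inr j) => - grad (fun w => h (col_mx x w) j 0) y end.
have [|l l0] := farkas _ _ _ a (- grad (fun w => f (col_mx x w)) y).
  move=> d ad; apply: df_polar; split => [i gi0|j].
    by have := ad (inl i); rewrite /= gi0 eqxx.
  apply/eqP; rewrite eq_le (ad (inr (inl j)))/=.
  by have := ad (inr (inr j)); rewrite /= dotNl oppr_le0.
rewrite !big_sumType/= => fl.
(* The Farkas coefficient of a zero generator is arbitrary; resetting it to 0 gives complementarity.
   The sign-free [v] is the difference of the two coefficients of each equality. *)
pose u : 'cV[R]_p := \col_i if g (col_mx x y) i 0 == 0 then l (inl i) else 0.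
pose v : 'cV[R]_q := \col_j (l (inr (inl j)) - l (inr (inr j))).
exists u, v; split; first by move=> i; rewrite mxE; case: ifP.
split.
- rewrite grad_lagrangian -addrA; apply/eqP; rewrite addrC addr_eq0 fl.
  rewrite !gradv_mul; apply/eqP; congr (_ + _).
    apply: eq_bigr => i _; rewrite mxE.
    by case: ifP; rewrite ?scaler0 ?scale0r.
  rewrite -big_split/=; apply: eq_bigr => j _.
  by rewrite mxE scalerBl scalerN.
- move=> i; rewrite mxE mxE; case: ifP => [/eqP->|_]; first by rewrite mulr0.
  by rewrite mul0r.
- by apply/colP => j; rewrite hy !mxE mulr0.
Qed.

End lower_level.

(** * Equivalence of the two programs *)

Theorem theorem6p1 (R : realType) (n m p q : nat)
    (Omega : set 'cV[R]_(n + m)) (F f : 'cV[R]_(n + m) -> R)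
    (g : 'cV[R]_(n + m) -> 'cV[R]_p) (h : 'cV[R]_(n + m) -> 'cV[R]_q)
    (F_C1 : C1 F) (f_C2 : C2 f) (g_C2 : C2v g) (h_C2 : C2v h)
    (S_neq0 : forall x, upper_proj Omega x -> lower_sol f g h x !=set0)
    (f_pseudoconvex : forall x u v, upper_proj Omega x -> nonnegv u ->
      pseudoconvex_on (lower_feas g h x `|` Zprime f g h x u v)
        (fun y => f (col_mx x y)))
    (gh_quasiconvex : forall x u v, upper_proj Omega x -> nonnegv u ->
      quasiconvex_on (lower_feas g h x `|` Zprime f g h x u v)
        (fun y => dot u (g (col_mx x y)) + dot v (h (col_mx x y))))
    (guignard : forall x, upper_proj Omega x ->
      exists2 y, lower_sol f g h x y & guignard_cq g h x y) :
  (forall x y, BP_sol Omega F f g h (x, y) ->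
    exists z u v, eMDP_sol Omega F f g h (x, y, z, u, v)) /\
  (forall x y z u v, eMDP_sol Omega F f g h (x, y, z, u, v) ->
    BP_sol Omega F f g h (x, y)).
Proof.
have projP x y : Omega (col_mx x y) -> upper_proj Omega x by exists y.
have weak x y z u v : upper_proj Omega x -> nonnegv u ->
    lower_feas g h x y -> Zprime f g h x u v z ->
    f (col_mx x z) <= f (col_mx x y).
  move=> xX u0; apply: mond_weir_weak_duality => //.
    exact: f_pseudoconvex.
  exact: gh_quasiconvex.
have eMDP_BP x y z u v : eMDP_feas Omega f g h (x, y, z, u, v) ->
    BP_feas Omega f g h (x, y).
  move=> [Oxy gxy hxy fyz [ugz vhz Lz u0]]; split=> //; split=> // w wY.
  (* The value at [z] is an intermediate bound: it dominates that at [y] and, by weak duality, is at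
     most that at any feasible [w]. *)
  rewrite subr_le0 in fyz; apply: (le_trans fyz).
  apply: (weak _ _ _ u v (projP _ _ Oxy) u0 wY); split=> //.
  by rewrite grad_lagrangian.
have BP_eMDP x y : BP_feas Omega f g h (x, y) ->
    exists z u v, eMDP_feas Omega f g h (x, y, z, u, v).
  move=> [Oxy [[gxy hxy] ymin]].
  have [z zS zG] := guignard x (projP _ _ Oxy).
  have [u [v [u0 [Lz ugz vhz]]]] : exists u v,
      nonnegv u /\ Zprime f g h x u v z by exact: guignard_kkt.
  exists z, u, v; split => //; first by rewrite subr_le0; apply: ymin; case: zS.
  by split => //; rewrite -grad_lagrangian.
(* Both objectives depend on [(x, y)] alone, so competitors are carried from one program to the
   other at equal value. *)
split=> [x y [xyBP xymin]|x y z u v [xyzuv xymin]].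
  have [z [u [v xyzuv]]] := BP_eMDP _ _ xyBP.
  exists z, u, v; split=> // -[[[[x' y'] z'] u'] v'] /eMDP_BP.
  exact: xymin.
split; first exact: eMDP_BP xyzuv.
move=> [x' y'] /BP_eMDP[z' [u' [v' feas']]].
exact: xymin feas'.
Qed.
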